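(* Let $p$ be a prime, $\alpha,n\in\mathbb{N}$ and $r\in\mathbb{Z}$. Let $f(x)\in\mathbb{Q}_p[x]$ with $\deg f\leqslant l\in\mathbb{N}$ and $f(a)\in\mathbb{Z}_p$ for all $a\in\mathbb{Z}$. Then $$\operatorname{ord}_p\Bigg(\sum_{k\equiv r\ (\mathrm{mod}\ p^{\alpha})}\binom nk(-1)^kf\Big(\frac{k-r}{p^{\alpha}}\Big)\Bigg)\ \geqslant\ \operatorname{ord}_p\Big(\Big\lfloor\frac n{p^{\alpha-1}}\Big\rfloor!\Big)-l-\operatorname{ord}_p(l!)+\tau_p\big(\{r\}_{p^{\alpha-1}},\{n-r\}_{p^{\alpha-1}}\big).$$
   Context: The sum runs over all integers $k\equiv r\pmod{p^\alpha}$, with $\binom nk=0$ unless $0\le k\le n$. $\mathbb{Q}_p,\mathbb{Z}_p$ are the $p$-adic numbers and integers; $\operatorname{ord}_p(\omega)=\max\{a\in\mathbb{Z}:\omega/p^a\in\mathbb{Z}_p\}$ for $\omega\ne0$, $\operatorname{ord}_p(0)=+\infty$. For an integer $a$ and positive real $m$, $\{a\}_m$ is the unique number in $[0,m)$ with $a-\{a\}_m\in m\mathbb{Z}$. $\tau_p(a,b)$ is the number of carries when adding $a,b\in\mathbb{N}$ in base $p$. When $\alpha=0$, $\lfloor n/p^{-1}\rfloor=pn$. *)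

(* Defs.v *)
From mathcomp Require Import all_boot all_order all_algebra.
Set Implicit Arguments. Unset Strict Implicit. Unset Printing Implicit Defensive.
Import Order.TTheory GRing.Theory Num.Theory.
Local Open Scope ring_scope.

(* A field K equipped with a valuation v extending the p-adic valuation ord_p
   of Q (e.g. K = Q_p, v = ord_p).  v is only meaningful on nonzero elements;
   ord_p(0) = +oo is handled separately in the statement. *)
Definition padic_valuation (p : nat) (K : fieldType) (v : K -> int) : Prop :=
  [/\ forall n : nat, (0 < n)%N -> n%:R != 0 :> K,
      forall n : nat, (0 < n)%N -> v n%:R = (logn p n)%:Z,
      forall x y : K, x != 0 -> y != 0 -> v (x * y) = v x + v y &
      forall x y : K, x != 0 -> y != 0 -> x + y != 0 ->
        Num.min (v x) (v y) <= v (x + y)].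

Definition in_val_ring (K : fieldType) (v : K -> int) (x : K) : Prop :=
  x = 0 \/ 0 <= v x.

(* floor(n / p^(alpha-1)), with the convention floor(n/p^(-1)) = p n *)
Definition floor_div_pow (p alpha n : nat) : nat :=
  if alpha is a.+1 then (n %/ p ^ a)%N else (p * n)%N.

(* {a}_{p^(alpha-1)}: least nonnegative residue of a mod p^(alpha-1);
   for alpha = 0 the modulus is 1/p and every integer is in (1/p)Z, so 0. *)
Definition frac_part (p alpha : nat) (a : int) : nat :=
  if alpha is b.+1 then `|(a %% (p ^ b)%:Z)%Z|%N else 0%N.

Fixpoint carries_aux (p fuel a b c : nat) : nat :=
  match fuel with
  | 0 => 0
  | f.+1 =>
      let c' := (p <= a %% p + b %% p + c)%N in
      (c' + carries_aux p f (a %/ p) (b %/ p) c')%N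
  end.

(* tau_p(a,b); a+b+1 digit positions are more than enough for p >= 2 *)
Definition tau (p a b : nat) : nat := carries_aux p (a + b).+1 a b 0.

(* Main.v *)
Require Import Defs.
From mathcomp Require Import all_boot all_order all_algebra.
From mathcomp Require Import zify ring.
Import Order.TTheory GRing.Theory Num.Theory.
Local Open Scope ring_scope.

(** Newton's formula writes [f] as a combination of falling factorials [(x)_j],
    [j <= l], with coefficients in [j!^-1 Z_p].  It therefore suffices that
    [p ^ l * U_alpha(n, r, l)] is divisible by [p] to the power
    [ord_p(floor(n / p^(alpha-1))!) + tau], where [U_alpha(n, r, l)] is the sum
    of the statement for [f = (x)_l].

    For [alpha = 0] the sum is an explicit [n]-th difference.  For [alpha = 1],
    induct on [l] by means of [p (x)_{l+1} = (k - r - p l) (x)_l] with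
    [x = (k - r) / p], starting from Fleck's congruence.  For the step from [Q = p ^ alpha],
    [alpha >= 1], to [p Q], write [r = i + Q r'] with [0 <= i < Q] and expand the function of
    [(k - i) / Q] by Newton's formula:
      [U_{alpha+1}(n, r, l) = \sum_(t <= m) (-1)^t A_t U_1(t, r', l)],
    where [m = floor(n / Q)] and [t! A_t = U_alpha(n, i, t)].  If [t < m], the
    induction hypothesis exceeds the required exponent by [m - t >= 1], which
    pays for the at most one carry created by the additional digit.  If [t = m], [A_m] is
    [0] or [+- 'C(n, i + Q m)], and Kummer's theorem provides the carries. *)

(** * Alternating binomial sums as iterated differences *)

Definition alt_sum (R : comNzRingType) (n : nat) (h : nat -> R) : R :=
  \sum_(0 <= k < n.+1) 'C(n, k)%:R * (-1) ^+ k * h k.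
Arguments alt_sum {R} n h.

Section AltSum.
Variable R : comNzRingType.
Implicit Types (h g : nat -> R) (n : nat).

Lemma alt_sum0 h : alt_sum 0 h = h 0%N.
Proof. by rewrite /alt_sum big_nat1 bin0 expr0 !mul1r. Qed.

Lemma eq_alt_sum n h g : (forall k, (k <= n)%N -> h k = g k) ->
  alt_sum n h = alt_sum n g.
Proof. by move=> e; apply: eq_big_nat => k /andP[_ lk]; rewrite e. Qed.

Lemma alt_sumD n h g :
  alt_sum n (fun k => h k + g k) = alt_sum n h + alt_sum n g.
Proof. by rewrite -big_split; apply: eq_bigr => k _; rewrite mulrDr. Qed.

Lemma alt_sumZ n a h : alt_sum n (fun k => a * h k) = a * alt_sum n h.
Proof. by rewrite /alt_sum mulr_sumr; apply: eq_bigr => k _; rewrite mulrCA. Qed.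

Lemma alt_sum_exchange (I : Type) (s : seq I) n (h : I -> nat -> R) :
  alt_sum n (fun k => \sum_(i <- s) h i k) = \sum_(i <- s) alt_sum n (h i).
Proof.
by rewrite exchange_big; apply: eq_bigr => k _; rewrite mulr_sumr.
Qed.

Lemma alt_sumS n h :
  alt_sum n.+1 h = alt_sum n h - alt_sum n (fun k => h k.+1).
Proof.
rewrite /alt_sum big_nat_recl // [in X in X - _]big_nat_recl //.
rewrite !bin0 -addrA; congr (_ + _).
under eq_bigr => k _ do rewrite binS natrD !mulrDl.
rewrite big_split /=; congr (_ + _).
  rewrite big_nat_recr //= bin_small //.
  by rewrite !mul0r addr0.
by rewrite -sumrN; apply: eq_bigr => k _; rewrite exprS mulN1r mulrN mulNr.
Qed.

(** The absorption identity for binomials; the factor [n.+1] later turns n! into (n+1)!. *)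
Lemma alt_sum_absorb n h :
  alt_sum n.+1 (fun k => k%:R * h k)
  = - n.+1%:R * alt_sum n (fun k => h k.+1).
Proof.
rewrite /alt_sum big_nat_recl // mul0r mulr0 add0r mulr_sumr.
apply: eq_bigr => k _; rewrite exprS.
have -> : 'C(n.+1, k.+1)%:R * (-1 * (-1) ^+ k) * (k.+1%:R * h k.+1)
  = - ((k.+1 * 'C(n.+1, k.+1))%N%:R * (-1) ^+ k * h k.+1) :> R.
  by rewrite natrM; ring.
by rewrite -mul_bin_diag natrM; ring.
Qed.

(** With E the shift, [alt_sum n h] is (1 - E)^n h at 0, and powers of 1 - E compose. *)
Lemma alt_sum_add m n h :
  alt_sum (m + n) h = alt_sum m (fun j => alt_sum n (fun k => h (k + j)%N)).
Proof.
elim: m h => [|m IH] h.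
  by rewrite alt_sum0; apply: eq_alt_sum => k _; rewrite addn0.
rewrite addSn !alt_sumS !IH; congr (_ - _).
by apply: eq_alt_sum => j _; apply: eq_alt_sum => k _; rewrite addnS.
Qed.

Lemma alt_sum_const n (c : R) : alt_sum n.+1 (fun=> c) = 0.
Proof. by rewrite alt_sumS subrr. Qed.

(** Expand E^j = (1 - (1 - E))^j. Terms with t > j vanish, so one bound [N] can serve several
    [j]. *)
Lemma newton_forward h j N : (j <= N)%N ->
  h j = \sum_(0 <= t < N.+1) 'C(j, t)%:R * (-1) ^+ t * alt_sum t h.
Proof.
elim: j N h => [|j IH] N h.
  move=> _; rewrite big_nat_recl // big1 ?addr0 => [|t _].
    by rewrite alt_sum0 bin0 expr0 !mul1r.
  by rewrite bin0n !mul0r.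
case: N => // N jN; rewrite (IH N (fun k => h k.+1)) //.
have e t : alt_sum t (fun k => h k.+1) = alt_sum t h - alt_sum t.+1 h.
  by rewrite alt_sumS subKr.
under eq_bigr => t _ do rewrite e mulrBr.
rewrite big_split /= [RHS]big_nat_recl //.
under [in RHS]eq_bigr => t _ do rewrite binS natrD !mulrDl.
rewrite big_split /= addrA; congr (_ + _).
  rewrite big_nat_recl // !bin0; congr (_ + _).
  by rewrite [RHS]big_nat_recr //= bin_small // !mul0r addr0.
by apply: eq_bigr => t _; rewrite exprS; ring.
Qed.

End AltSum.

(** * Residue classes and falling factorials over the integers *)

Definition on_class (R : comNzRingType) (q : nat) (r : int) (g : int -> R)
    (k : nat) : R :=
  if (q%:Z %| k%:Z - r)%Z then g ((k%:Z - r) %/ q%:Z)%Z else 0.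
Arguments on_class {R} q r g k.

(** The falling factorial (x)_l on all of [int], since (k - r) / q may be negative. *)
Definition ffactz (l : nat) (x : int) : int := \prod_(i < l) (x - i%:Z).

Lemma ffactzS l x : ffactz l.+1 x = ffactz l x * (x - l%:Z).
Proof. exact: big_ord_recr. Qed.

Lemma ffactz_nat l (j : nat) : ffactz l j%:Z = (j ^_ l)%N%:Z.
Proof.
elim: l => [|l IH]; first by rewrite /ffactz big_ord0 ffactn0.
rewrite ffactzS IH ffactnSr PoszM.
have [lj|jl] := leqP l j; first by rewrite subzn.
by rewrite ffact_small // !mul0r.
Qed.

Lemma ffactz_shift l x : ffactz l.+1 (x + 1) = ffactz l x * (x + 1).
Proof.
rewrite /ffactz big_ord_recl subr0 mulrC; congr (_ * _).
by apply: eq_bigr => i _; rewrite lift0 -addn1 PoszD; ring.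
Qed.

Lemma ffactz_diff l x :
  ffactz l.+1 x - ffactz l.+1 (x + 1) = - l.+1%:Z * ffactz l x.
Proof. by rewrite ffactz_shift ffactzS -addn1 PoszD; ring. Qed.

(** Each difference lowers the degree by one, by [ffactz_diff]. For n > l the factor [l ^_ n] is 0,
    so the truncated [l - n] does no harm. *)
Lemma alt_sum_ffactz n l (c : int) :
  alt_sum n (fun k => ffactz l (k%:Z + c))
  = (-1) ^+ n * (l ^_ n)%N%:Z * ffactz (l - n) c.
Proof.
elim: n l => [|n IH] l.
  by rewrite alt_sum0 add0r subn0 ffactn0 expr0 !mul1r.
rewrite alt_sumS.
case: l => [|l].
  have e (c' : nat -> int) : alt_sum n (fun k => ffactz 0 (c' k)) = alt_sum n (fun=> 1).
    by apply: eq_alt_sum => k _; rewrite /ffactz big_ord0.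
  by rewrite !e subrr mulr0 mul0r.
rewrite subSS ffactSS PoszM.
have -> : alt_sum n (fun k => ffactz l.+1 (k%:Z + c))
    = alt_sum n (fun k => ffactz l.+1 (k.+1%:Z + c))
      + - l.+1%:Z * alt_sum n (fun k => ffactz l (k%:Z + c)).
  rewrite -alt_sumZ -alt_sumD; apply: eq_alt_sum => k _.
  rewrite -ffactz_diff -[k.+1]addn1 PoszD.
  by rewrite [k%:Z + 1 + c]addrAC addrCA subrr addr0.
by rewrite addrAC subrr add0r IH exprS; ring.
Qed.

(** * Legendre's formula, carries and Kummer's theorem *)

Lemma sum_nat_wide (F : nat -> nat) m n N : (m <= n <= N)%N ->
  (forall k, (n <= k)%N -> F k = 0%N) ->
  (\sum_(m <= k < N) F k = \sum_(m <= k < n) F k)%N.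
Proof.
case/andP=> mn nN F0; rewrite (big_cat_nat mn nN) /= [X in (_ + X)%N]big_nat_cond.
by rewrite [X in (_ + X)%N]big1 ?addn0 // => k /andP[/andP[/F0]].
Qed.

Lemma logn_fact_wide p n N : prime p -> (n <= N)%N ->
  logn p n`! = (\sum_(1 <= k < N.+1) n %/ p ^ k)%N.
Proof.
move=> pp nN; rewrite logn_fact //; apply/esym/sum_nat_wide; first by rewrite ltnS.
move=> k nk; apply: divn_small; apply: leq_trans nk _.
exact/ltnW/ltn_expl/prime_gt1.
Qed.

Lemma logn_fact_div p n : prime p ->
  logn p n`! = (n %/ p + logn p (n %/ p)`!)%N.
Proof.
move=> pp; have p0 := prime_gt0 pp.
rewrite (logn_fact_wide p n n.+1) // big_nat_recl // expn1; congr (_ + _)%N.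
rewrite (logn_fact_wide p _ n) ?leq_div //.
by apply: eq_bigr => k _; rewrite expnS divnMA.
Qed.

(** With m the quotient of n by p and m > 0, induction gives (p-1) ord_p(n!) = (p-1) m + (p-1)
    ord_p(m!) < p m <= n. *)
Lemma logn_fact_lt p n : prime p -> (0 < n)%N -> (p.-1 * logn p n`! < n)%N.
Proof.
move=> pp; have p1 := prime_gt1 pp; elim/ltn_ind: n => n IH n0.
rewrite logn_fact_div //.
have [m0|m0] := posnP (n %/ p)%N; first by rewrite m0 fact0 logn1 muln0.
have := IH _ (ltn_Pdiv p1 n0) m0; have := leq_divM n p; move: (logn _ _) => L.
by case: p {IH pp} p1 m0 => // p _ _ /=; nia.
Qed.

(** Induction by stripping the lowest digit; the j-th summand is the carry out of the j lowest
    positions. *)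
Lemma carries_auxE p fuel a b (c : bool) : (0 < p)%N ->
  carries_aux p fuel a b c =
  (\sum_(1 <= j < fuel.+1) (p ^ j <= a %% p ^ j + b %% p ^ j + c))%N.
Proof.
move=> p0; elim: fuel a b c => [|f IH] a b c; first by rewrite big_geq.
rewrite /= IH [RHS]big_nat_recl // expn1; congr (_ + _)%N.
apply: eq_big_nat => j _; congr nat_of_bool.
have e x : (x %% p ^ j.+1 = x %/ p %% p ^ j * p + x %% p)%N.
  by rewrite modn_divl -expnSr {1}(divn_eq (x %% p ^ j.+1) p) modn_dvdm // expnS dvdn_mulr.
rewrite !e expnS; have := ltn_pmod a p0; have := ltn_pmod b p0.
move: (p ^ j)%N (a %/ p %% _)%N (b %/ p %% _)%N (a %% p)%N (b %% p)%N => P A B a0 b0 la lb.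
have := leq_b1 c; move: (nat_of_bool c) => c0 c1.
have -> : (A * p + a0 + (B * p + b0) + c0 = (A + B) * p + (a0 + b0 + c0))%N by ring.
(* Division by p keeps only the carry of the lowest digits, at most 1 because a0 + b0 + c0 < 2 p. *)
rewrite mulnC -leq_divRL // divnMDl //; congr (_ <= _ + _)%N.
case: leqP => h /=; last by rewrite divn_small.
apply/esym/eqP; rewrite eqn_leq leq_divRL // mul1n h andbT -ltnS ltn_divLR //; lia.
Qed.

Lemma tauE p a b N : prime p -> (a + b < p ^ N)%N ->
  tau p a b = (\sum_(1 <= j < N) (p ^ j <= a %% p ^ j + b %% p ^ j))%N.
Proof.
move=> pp abN; have p1 := prime_gt1 pp; rewrite /tau (carries_auxE _ _ _ _ false) ?prime_gt0 //.
under eq_bigr => j _ do rewrite addn0.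
(* Both ranges are extended to a common bound; the added positions carry nothing. *)
pose M := maxn (a + b).+2 N.
have z k n : (a + b < p ^ n)%N -> (n <= k)%N -> (p ^ k <= a %% p ^ k + b %% p ^ k)%N = 0%N :> nat.
  move=> abn nk; apply/eqP; rewrite eqb0 -ltnNge.
  apply: leq_ltn_trans (leq_add (leq_mod _ _) (leq_mod _ _)) _.
  by apply: leq_trans abn _; rewrite leq_exp2l.
have w n : (a + b < p ^ n)%N -> (n <= M)%N ->
    (\sum_(1 <= j < n) (p ^ j <= a %% p ^ j + b %% p ^ j) =
     \sum_(1 <= j < M) (p ^ j <= a %% p ^ j + b %% p ^ j))%N.
  case: n => [|n] abn nM.
    rewrite big_geq // big1 // => j _; exact: z abn _.
  by apply/esym/sum_nat_wide => // k; apply: z.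
rewrite [RHS]w ?leq_maxr // [LHS]w ?leq_maxl //.
by apply: ltn_trans (ltn_expl _ p1); rewrite ltnS leqnSn.
Qed.

(** By Legendre's formula: for each p^j, the quotient of a + b exceeds the sum of the quotients of a
    and b by the j-th carry. *)
Lemma kummer p a b : prime p -> logn p 'C(a + b, a) = tau p a b.
Proof.
move=> pp; have p1 := prime_gt1 pp.
rewrite (tauE _ _ _ (a + b).+1 pp); last first.
  by apply: ltn_trans (ltn_expl _ p1).
have C0 : (0 < 'C(a + b, a))%N by rewrite bin_gt0 leq_addr.
have := congr1 (logn p) (bin_fact (leq_addr b a)).
rewrite addKn !lognM ?muln_gt0 ?fact_gt0 //.
rewrite !(logn_fact_wide p _ (a + b)) ?leq_addl ?leq_addr //.
under [RHS]eq_bigr => j _ do rewrite divnD ?expn_gt0 ?prime_gt0 //.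
rewrite !big_split /= addnC => e; exact: addnI e.
Qed.

(** Two residues mod p^e add up to less than p^(e+1), so only the e lowest carries can occur. *)
Lemma tau_modE p a b e : prime p ->
  tau p (a %% p ^ e) (b %% p ^ e) =
  (\sum_(1 <= j < e.+1) (p ^ j <= a %% p ^ j + b %% p ^ j))%N.
Proof.
move=> pp; have p1 := prime_gt1 pp; have p0 := prime_gt0 pp.
have P0 : (0 < p ^ e)%N by rewrite expn_gt0 p0.
rewrite (tauE _ _ _ e.+1 pp).
  apply: eq_big_nat => j /andP[_ je].
  by rewrite !modn_dvdm ?dvdn_exp2l.
rewrite expnS; have := ltn_pmod a P0; have := ltn_pmod b P0.
by move: (_ %% _)%N (_ %% _)%N => u w; nia.
Qed.

Lemma tau_mod_le p a b e : prime p ->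
  (tau p (a %% p ^ e) (b %% p ^ e) <= tau p a b)%N.
Proof.
move=> pp; have p1 := prime_gt1 pp; rewrite tau_modE //.
have ab : (a + b < p ^ (a + b + e).+1)%N.
  by apply: ltn_trans (ltn_expl _ p1); rewrite ltnS leq_addr.
have eN : (e.+1 <= (a + b + e).+1)%N by rewrite ltnS leq_addl.
by rewrite (tauE _ _ _ _ pp ab) [leqRHS](big_cat_nat (isT : (1 <= e.+1)%N) eN) leq_addr.
Qed.

Lemma tau_modS_le p a b e : prime p ->
  (tau p (a %% p ^ e.+1) (b %% p ^ e.+1) <= (tau p (a %% p ^ e) (b %% p ^ e)).+1)%N.
Proof.
by move=> pp; rewrite !tau_modE // [leqLHS]big_nat_recr //= -[leqRHS]addn1 leq_add2l leq_b1.
Qed.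

(** * Fleck's congruence and the modulus [p] *)

Lemma on_class_shift (R : comNzRingType) q r (g : int -> R) k j :
  on_class q r g (k + j)%N = on_class q (r - j%:Z) g k.
Proof. by rewrite /on_class PoszD opprB addrA. Qed.

Lemma on_class_nat (R : comNzRingType) q i (g : int -> R) k : (i < q)%N ->
  on_class q i%:Z g k = if (k %% q == i)%N then g (k %/ q)%N%:Z else 0.
Proof.
move=> iq; rewrite /on_class -eqz_mod_dvd !modz_nat eqz_nat (modn_small iq).
case: eqP => // ki; congr g.
have q0 : q%:Z != 0 by rewrite eqz_nat -lt0n (leq_ltn_trans _ iq).
by rewrite {1}(divn_eq k q) ki PoszD addrK PoszM mulzK.
Qed.

(** The indicator of a class mod p, summed over p successive shifts, is constant, so one more
    difference kills it. *)
Lemma sum_residues p (x : int) : (0 < p)%N ->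
  \sum_(0 <= j < p) (if (p%:Z %| x + j%:Z)%Z then 1 else 0 : int) = 1.
Proof.
move=> p0; pose i := `|((- x) %% p%:Z)%Z|%N.
have pz : p%:Z != 0 by rewrite eqz_nat -lt0n.
have iE : i%:Z = ((- x) %% p%:Z)%Z by rewrite gez0_abs ?modz_ge0.
have ip : (i < p)%N by rewrite -ltz_nat iE ltz_pmod.
rewrite (bigD1_seq i) ?mem_index_iota ?iota_uniq //= big_nat_cond big1 => [|j].
  rewrite addr0 iE -[x in x + _]opprK addrC -eqz_mod_dvd modz_mod eqxx //.
move=> /andP[/andP[_ jp] ji]; case: ifP => // h; case/negP: ji.
rewrite -eqz_nat iE -(@modz_small j%:Z p%:Z) ?ltz_nat //.
by rewrite eqz_mod_dvd opprK addrC.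
Qed.

(** Neighbours in row p - 1 of Pascal's triangle add up to a multiple of p, so they are opposite mod
    p. *)
Lemma bin_pred_prime_mod p j : prime p -> (j < p)%N ->
  (p%:Z %| 'C(p.-1, j)%:Z * (-1) ^+ j - 1)%Z.
Proof.
move=> pp; have p0 := prime_gt0 pp; elim: j => [|j IH] jp.
  by rewrite bin0 mul1r subrr dvdz0.
have -> : 'C(p.-1, j.+1)%:Z * (-1) ^+ j.+1 - 1 =
  'C(p, j.+1)%:Z * (-1) ^+ j.+1 + ('C(p.-1, j)%:Z * (-1) ^+ j - 1) :> int.
  by rewrite -{2}(prednK p0) binS PoszD exprS; ring.
apply: rpredD; last exact/IH/ltnW.
by rewrite dvdz_mulr // dvdzE /= prime_dvd_bin.
Qed.

(** Each further factor p costs p - 1 differences: split n = (p - 1) + n' and apply the induction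
    hypothesis to every shifted inner sum. *)
Lemma fleck p e n r : prime p -> (p.-1 * e < n)%N ->
  (p%:Z ^+ e %| alt_sum n (on_class p r (fun=> 1)))%Z.
Proof.
move=> pp; have p0 := prime_gt0 pp.
elim: e n r => [|e IH] n r; first by rewrite dvd1z.
rewrite mulnS => en; pose n' := (n - p.-1)%N.
have nE : n = (p.-1 + n')%N by rewrite subnKC // (leq_trans (leq_addr _ _) (ltnW en)).
have en' : (p.-1 * e < n')%N by rewrite ltn_subRL.
pose W j := alt_sum n' (fun k => on_class p r (fun=> 1 : int) (k + j)%N).
have Wd j : (p%:Z ^+ e %| W j)%Z.
  rewrite /W (eq_alt_sum _ _ _ (on_class p (r - j%:Z) (fun=> 1))) ?IH // => k _.
  exact: on_class_shift.
rewrite nE alt_sum_add [alt_sum p.-1 _]/alt_sum prednK // -/W.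
have W0 : \sum_(0 <= j < p) W j = 0.
  rewrite -alt_sum_exchange; case: (n') en' => // n'' _.
  rewrite -[RHS](alt_sum_const _ n'' 1); apply: eq_alt_sum => k _.
  rewrite -[RHS](sum_residues p (k%:Z - r) p0); apply: eq_bigr => j _.
  by rewrite on_class_shift /on_class opprB addrA addrAC.
(* Since 'C(p.-1, j) * (-1) ^+ j = 1 %[mod p], subtracting the vanishing
   complete sum of W gains one factor p. *)
rewrite -[X in (_ %| X)%Z]subr0 -[X in _ - X]W0 -sumrB big_nat_cond.
apply: rpred_sum => j /andP[/andP[_ jp] _].
have -> : 'C(p.-1, j)%:R * (-1) ^+ j * W j - W j
  = ('C(p.-1, j)%:R * (-1) ^+ j - 1) * W j by rewrite mulrBl mul1r.
by rewrite exprS dvdz_mul // natz bin_pred_prime_mod.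
Qed.

(** For l = 0 this is [fleck] with e = ord_p(n!), admissible by [logn_fact_lt]. In the step, the
    part with factor k is handled by [alt_sum_absorb]. *)
Lemma fleck_ffactz p n l r : prime p ->
  (p%:Z ^+ logn p n`! %| p%:Z ^+ l * alt_sum n (on_class p r (ffactz l)))%Z.
Proof.
move=> pp; elim: l n r => [|l IH] n r.
  rewrite mul1r; case: n => [|n]; first by rewrite fact0 logn1 dvd1z.
  rewrite (eq_alt_sum _ _ _ (on_class p r (fun=> 1))).
    exact/fleck/logn_fact_lt.
  by move=> k _; rewrite /on_class /ffactz big_ord0.
have -> : p%:Z ^+ l.+1 * alt_sum n (on_class p r (ffactz l.+1)) =
  p%:Z ^+ l * alt_sum n (fun k => k%:R * on_class p r (ffactz l) k)
  + - (r + p%:Z * l%:Z) * (p%:Z ^+ l * alt_sum n (on_class p r (ffactz l))).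
  rewrite [X in _ = _ + X]mulrCA exprSr -mulrA -mulrDr; congr (_ * _).
  rewrite -!alt_sumZ -alt_sumD; apply: eq_alt_sum => k _.
  rewrite /on_class; case: ifP => [h|_]; last by rewrite !mulr0 addr0.
  rewrite ffactzS -mulrDl mulrCA mulrC; congr (_ * _).
  by rewrite mulrBr [p%:Z * (_ %/ _)%Z]mulrC divzK // natz; ring.
apply: rpredD; last exact: dvdz_mull.
case: n => [|n]; first by rewrite fact0 logn1 dvd1z.
rewrite alt_sum_absorb factS lognM ?fact_gt0 // exprD mulrCA dvdz_mul //.
  rewrite dvdzE abszX abszN natz; exact: pfactor_dvdnn.
rewrite (eq_alt_sum _ _ _ (on_class p (r - 1) (ffactz l))) // => k _.
by rewrite -addn1 on_class_shift.
Qed.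

(** * Refining the modulus, and induction on its exponent *)

(** On the class of i mod Q, (k - i) / Q is [k %/ Q], so the absolute value is a mere conversion to
    [nat]. *)
Lemma on_class_refine (R : comNzRingType) (Q p : nat) i r (g : int -> R) k :
  (i < Q)%N -> on_class (Q * p) (i%:Z + Q%:Z * r) g k
  = on_class Q i%:Z (fun x => on_class p r g `|x|%N) k.
Proof.
move=> iQ; rewrite on_class_nat // /on_class.
have Q0 : Q%:Z != 0 by rewrite eqz_nat -lt0n (leq_ltn_trans _ iQ).
case: eqP => ki.
  have -> : k%:Z - (i%:Z + Q%:Z * r) = Q%:Z * ((k %/ Q)%N%:Z - r).
    by rewrite {1}(divn_eq k Q) ki PoszD PoszM; ring.
  by rewrite PoszM dvdz_mul2l // divzMpl // lt0r Q0.
case: ifP => // h; case: ki.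
have : (Q%:Z %| k%:Z - i%:Z)%Z.
  have -> : k%:Z - i%:Z = k%:Z - (i%:Z + Q%:Z * r) + Q%:Z * r by ring.
  apply: rpredD; last exact: dvdz_mulr.
  by apply: dvdz_trans h; rewrite PoszM dvdz_mulr.
by rewrite -eqz_mod_dvd !modz_nat eqz_nat (modn_small iQ) => /eqP.
Qed.

(** Newton's formula in the variable [k %/ Q], which is at most [n %/ Q] for every k <= n; then the
    sums are exchanged. *)
Lemma alt_sum_refine (R : comNzRingType) n (Q p : nat) i r (g : int -> R) :
  (i < Q)%N -> alt_sum n (on_class (Q * p) (i%:Z + Q%:Z * r) g)
  = \sum_(0 <= t < (n %/ Q).+1) (-1) ^+ t *
      alt_sum n (on_class Q i%:Z (fun x => 'C(`|x|, t)%:R)) *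
      alt_sum t (on_class p r g).
Proof.
move=> iQ.
under [RHS]eq_bigr => t _ do rewrite mulrAC -alt_sumZ.
rewrite -alt_sum_exchange; apply: eq_alt_sum => k kn.
rewrite on_class_refine // on_class_nat //.
under eq_bigr => t _ do rewrite on_class_nat //.
case: eqP => ki; last by rewrite big1 // => t _; rewrite mulr0.
rewrite (newton_forward _ _ _ (n %/ Q)) ?leq_div2r //.
by apply: eq_bigr => t _ /=; ring.
Qed.

Lemma alt_sum_bin_ffactz n Q i t : (i < Q)%N ->
  alt_sum n (on_class Q i%:Z (ffactz t)) =
  t`!%:Z * alt_sum n (on_class Q i%:Z (fun x => 'C(`|x|, t)%:R : int)).
Proof.
move=> iQ; rewrite -alt_sumZ; apply: eq_alt_sum => k _.
rewrite !on_class_nat //; case: eqP => _; last by rewrite mulr0.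
by rewrite ffactz_nat -bin_ffact PoszM mulrC natz.
Qed.

Lemma dvdz_expM (p : nat) e e1 e2 (x y : int) : (e <= e1 + e2)%N ->
  (p%:Z ^+ e1 %| x)%Z -> (p%:Z ^+ e2 %| y)%Z -> (p%:Z ^+ e %| x * y)%Z.
Proof.
by move=> le xd yd; apply: dvdz_trans (dvdz_exp2l _ le) _; rewrite exprD dvdz_mul.
Qed.

(** The part of t! prime to p can be cancelled; only its power of p stays. *)
Lemma pdvd_fact_cancel p t e (A : int) : prime p ->
  (p%:Z ^+ (t + e) %| p%:Z ^+ t * (t`!%:Z * A))%Z ->
  (p%:Z ^+ e %| p%:Z ^+ logn p t`! * A)%Z.
Proof.
move=> pp; have p0 : p%:Z != 0 by rewrite eqz_nat -lt0n prime_gt0.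
rewrite exprD dvdz_mul2l ?expf_neq0 //.
have [u pu {1}->] := pfactor_coprime pp (fact_gt0 t).
have cu : coprimez (p%:Z ^+ e) u%:Z by rewrite coprimezE abszX /= coprimeXl.
by rewrite PoszM -mulrA Gauss_dvdzr // -[(p ^ _)%N%:Z]natz natrX natz.
Qed.

(* [res p e x] is [frac_part p e.+1 x]. *)
Definition res (p e : nat) (x : int) : nat := `|(x %% (p ^ e)%N%:Z)%Z|%N.

Lemma resE p e x : (0 < p)%N -> (res p e x)%:Z = (x %% (p ^ e)%N%:Z)%Z.
Proof.
by move=> p0; rewrite /res gez0_abs // modz_ge0 // eqz_nat -lt0n expn_gt0 p0.
Qed.

Lemma res_nat p e (a : nat) : res p e a%:Z = (a %% p ^ e)%N.
Proof. by rewrite /res modz_nat absz_nat. Qed.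

Lemma eq_res p e x y : ((p ^ e)%N%:Z %| x - y)%Z -> res p e x = res p e y.
Proof. by rewrite -eqz_mod_dvd /res => /eqP ->. Qed.

Lemma res_res p e e' x : (0 < p)%N -> (e <= e')%N ->
  res p e x = (res p e' x %% p ^ e)%N.
Proof.
move=> p0 ee; rewrite -res_nat; apply: eq_res; rewrite resE //.
rewrite {1}(divz_eq x (p ^ e')%N%:Z) addrK dvdz_mull //.
by rewrite dvdzE dvdn_exp2l.
Qed.

Lemma ltn_res p e x : (0 < p)%N -> (res p e x < p ^ e)%N.
Proof. by move=> p0; rewrite -ltz_nat resE // ltz_pmod // ltz_nat expn_gt0 p0. Qed.

Lemma ffactz_class_dvd p b n l r : prime p ->
  (p%:Z ^+ (logn p (n %/ p ^ b)`! + tau p (res p b r) (res p b (n%:Z - r))) %|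
     p%:Z ^+ l * alt_sum n (on_class (p ^ b.+1) r (ffactz l)))%Z.
Proof.
move=> pp; have p0 := prime_gt0 pp.
elim: b n l r => [|b IH] n l r.
  rewrite /res !modz1 /= /tau /= !mod0n !add0n leqNgt p0 /= divn1 expn1 !addn0.
  exact: fleck_ffactz.
set Q := (p ^ b.+1)%N; set m := (n %/ Q)%N.
pose i := res p b.+1 r.
have iQ : (i < Q)%N by apply: ltn_res.
have rE : r = i%:Z + Q%:Z * (r %/ Q%:Z)%Z.
  by rewrite /i resE // {1}(divz_eq r Q%:Z) addrC mulrC.
have mE : (n %/ p ^ b %/ p = m)%N by rewrite /m /Q expnSr divnMA.
set w := res p b.+1 (n%:Z - r).
(* As Q divides r - i, the induction hypothesis for the class of [i] concerns digits of the same
   [w]. *)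
have wE : w = res p b.+1 (n%:Z - i%:Z).
  apply: eq_res; rewrite rE -/Q.
  have -> : n%:Z - (i%:Z + Q%:Z * (r %/ Q%:Z)%Z) - (n%:Z - i%:Z)
     = - (Q%:Z * (r %/ Q%:Z)%Z) by ring.
  by rewrite rpredN dvdz_mulr.
rewrite [(p ^ b.+2)%N]expnSr -/Q [in alt_sum n _]rE alt_sum_refine // mulr_sumr big_nat_cond.
apply: rpred_sum => t /andP[/andP[_ tm] _]; rewrite -/i -/w.
set A := alt_sum n _; set B := alt_sum t _.
have -> : p%:Z ^+ l * ((-1) ^+ t * A * B) = (-1) ^+ t * (A * (p%:Z ^+ l * B)) by ring.
apply: dvdz_mull.
have Bd : (p%:Z ^+ logn p t`! %| p%:Z ^+ l * B)%Z by apply: fleck_ffactz.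
have [tm'|] := ltnP t m; last first.
  move=> mt; have {tm mt} tE : t = m by apply/eqP; rewrite eqn_leq mt andbT -ltnS.
  (* Here [B] supplies ord_p(m!), and [A] has to supply all the carries. *)
  rewrite tE in A B Bd *; rewrite addnC; apply: dvdz_expM Bd => //.
  rewrite /A /alt_sum big_nat_cond; apply: rpred_sum => k /andP[/andP[_]].
  rewrite ltnS => kn _; rewrite on_class_nat //; case: eqP => ki; last by rewrite mulr0 dvdz0.
  have [lt|mk] := ltnP (k %/ Q)%N m; first by rewrite /= (bin_small lt) mulr0 dvdz0.
  rewrite -mulrA; apply: dvdz_mulr; rewrite natz.
  (* The lowest [b.+1] digits of k and n - k are those of [i] and [w], so adding k and n - k has at
     least the carries of i + w. *)
  have wk : w = ((n - k) %% Q)%N.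
    rewrite wE -res_nat; apply: eq_res; rewrite -subzn // -/Q.
    have -> : n%:Z - i%:Z - (n%:Z - k%:Z) = k%:Z - i%:Z by ring.
    by rewrite -eqz_mod_dvd !modz_nat eqz_nat (modn_small iQ) ki.
  have C0 : (0 < 'C(n, k))%N by rewrite bin_gt0.
  rewrite dvdzE abszX /= pfactor_dvdn // -{1}(subnKC kn) kummer //.
  by rewrite -/i wk -ki; apply: tau_mod_le.
have := IH n t i%:Z; rewrite alt_sum_bin_ffactz // -/A.
rewrite (logn_fact_div _ (n %/ p ^ b)) // mE.
rewrite !(res_res _ b b.+1) // -wE res_nat (modn_small iQ) => h.
have tau_le := tau_modS_le p i w b pp.
have wQ : (w < Q)%N by apply: ltn_res.
rewrite (modn_small iQ) (modn_small wQ) in tau_le.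
(* The power p^(ord_p(t!)) taken from [B] offsets the t! by which the induction hypothesis differs
   from [A]. *)
suff : (p%:Z ^+ (logn p m`! + tau p i w) %| p%:Z ^+ logn p t`! * A)%Z.
  case/dvdzP: Bd => c ->; rewrite mulrCA [A * _]mulrC; apply: dvdz_mull.
apply: pdvd_fact_cancel => //; apply: dvdz_trans h; apply: dvdz_exp2l.
(* The hypothesis has exponent m + ord_p(m!) plus the carries in b digits, the goal t + ord_p(m!)
   plus those in b + 1 digits; t < m pays for the extra carry. *)
by lia.
Qed.

(** The sum is an n-th difference, zero for l < n. Otherwise p^l contributes p^n, [l ^_ n] is a
    multiple of n!, and ord_p((p n)!) = n + ord_p(n!). *)
Lemma ffactz_class_dvd1 p n l r : prime p ->
  (p%:Z ^+ logn p (p * n)`! %| p%:Z ^+ l * alt_sum n (on_class 1 r (ffactz l)))%Z.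
Proof.
move=> pp; rewrite logn_fact_div // mulKn ?prime_gt0 //.
rewrite (eq_alt_sum _ _ _ (fun k => ffactz l (k%:Z - r))) ?alt_sum_ffactz; last first.
  by move=> k _; rewrite /on_class dvd1z divz1.
have [ln|nl] := ltnP l n; first by rewrite ffact_small // mulr0 mul0r mulr0 dvdz0.
apply: (@dvdz_expM p _ n (logn p n`!)) => //; first exact: dvdz_exp2l.
rewrite dvdz_mulr // dvdz_mull // dvdzE abszX /= (dvdn_trans (pfactor_dvdnn _ _)) //.
by rewrite -bin_ffact dvdn_mull.
Qed.

Lemma ffactz_sum_dvd p alpha n l r : prime p ->
  (p%:Z ^+ (logn p (floor_div_pow p alpha n)`! +
            tau p (frac_part p alpha r) (frac_part p alpha (n%:Z - r))) %|
     p%:Z ^+ l * alt_sum n (on_class (p ^ alpha) r (ffactz l)))%Z.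
Proof.
move=> pp; case: alpha => [|b]; last exact: ffactz_class_dvd.
rewrite /tau /= mod0n !add0n leqNgt prime_gt0 //= !addn0.
exact: ffactz_class_dvd1.
Qed.

(** * Lower bounds for the valuation *)

(* [v 0] is a junk value, so [ord_p 0 = +oo] is the separate disjunct. *)
Definition val_ge (K : fieldType) (v : K -> int) (m : int) (x : K) : Prop :=
  x = 0 \/ m <= v x.
Arguments val_ge {K} v m x.

Section Valuation.
Variables (p : nat) (K : fieldType) (v : K -> int).
Hypothesis vP : padic_valuation p v.

Lemma val_geD m x y : val_ge v m x -> val_ge v m y -> val_ge v m (x + y).
Proof.
case: vP => _ _ _ vD [->|mx]; first by rewrite add0r.
case=> [->|my]; first by rewrite addr0; right.
have [->|x0] := eqVneq x 0; first by rewrite add0r; right.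
have [->|y0] := eqVneq y 0; first by rewrite addr0; right.
have [->|xy0] := eqVneq (x + y) 0; first by left.
by right; apply: le_trans (vD _ _ x0 y0 xy0); rewrite le_min mx.
Qed.

Lemma val_geM m n x y : val_ge v m x -> val_ge v n y -> val_ge v (m + n) (x * y).
Proof.
case: vP => _ _ vM _ [->|mx]; first by rewrite mul0r; left.
case=> [->|ny]; first by rewrite mulr0; left.
have [->|x0] := eqVneq x 0; first by rewrite mul0r; left.
have [->|y0] := eqVneq y 0; first by rewrite mulr0; left.
by right; rewrite vM // lerD.
Qed.

Lemma val_ge_le m n x : n <= m -> val_ge v m x -> val_ge v n x.
Proof. by move=> nm [->|mx]; [left|right; apply: le_trans mx]. Qed.

Lemma val_ge_sum m (I : eqType) (s : seq I) (F : I -> K) :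
  (forall i, i \in s -> val_ge v m (F i)) -> val_ge v m (\sum_(i <- s) F i).
Proof.
move=> h; rewrite big_seq; apply: big_ind => //; first by left.
exact: val_geD.
Qed.

Lemma val_int z : z != 0 -> v z%:~R = logn p `|z|%N.
Proof.
case: vP => ch vN vM _.
have n10 : -1 != 0 :> K by rewrite oppr_eq0 oner_eq0.
have vN1 : v (-1) = 0.
  (* Indeed 2 v(-1) = v(1) = ord_p(1) = 0. *)
  have := vM _ _ n10 n10; rewrite mulrNN mulr1 -[1]/(1%:R) vN // logn1; lia.
case: z => [[|n]|n] // _; first by rewrite -[_%:~R]/(n.+1%:R) vN.
by rewrite NegzE mulrNz -mulN1r vM // ?ch // vN1 add0r -[_%:~R]/(n.+1%:R) vN.
Qed.

Lemma val_ge_int e (z : int) : prime p -> (p%:Z ^+ e %| z)%Z -> val_ge v e%:Z z%:~R.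
Proof.
move=> pp; have [->|z0] := eqVneq z 0; first by left.
by rewrite dvdzE abszX pfactor_dvdn ?absz_gt0 //; right; rewrite val_int.
Qed.

Lemma val_ge_inv (n : nat) : (0 < n)%N -> val_ge v (- (logn p n)%:Z) n%:R^-1.
Proof.
case: vP => ch vN vM _ n0; right.
have := vM n%:R n%:R^-1 (ch _ n0).
rewrite invr_eq0 mulfV ?ch // -[1]/(1%:R) !vN // logn1 => /(_ isT); lia.
Qed.

(** Makes 0, ..., l distinct interpolation nodes in [newton_poly]. *)
Lemma natr_inj : injective (fun n : nat => n%:R : K).
Proof.
case: vP => ch _ _ _.
suff h m n : (m <= n)%N -> m%:R = n%:R :> K -> m = n.
  by move=> m n; case/orP: (leq_total m n) => le e; [apply: h|apply/esym/h].
move=> mn e; apply/eqP; rewrite eqn_leq mn /= -subn_eq0 -leqn0 leqNgt.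
by apply/negP => /ch; rewrite natrB // e subrr eqxx.
Qed.

End Valuation.

(** * Newton's formula for polynomials and the final estimate *)

Lemma intr_ffactz (K : fieldType) j x :
  (ffactz j x)%:~R = (\prod_(i < j) ('X - (i%:R)%:P)).[x%:~R] :> K.
Proof.
rewrite horner_prod rmorph_prod; apply: eq_bigr => i _.
by rewrite hornerXsubC rmorphB.
Qed.

(** Both sides are polynomials of degree at most l that agree at 0, ..., l by [newton_forward], as
    (k)_t is t! times a binomial. *)
Lemma newton_poly (p : nat) (K : fieldType) (v : K -> int) (f : {poly K}) l (x : int) :
  padic_valuation p v -> (size f <= l.+1)%N ->
  f.[x%:~R] = \sum_(0 <= j < l.+1) (-1) ^+ j * alt_sum j (fun k => f.[k%:R])
                / j`!%:R * (ffactz j x)%:~R.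
Proof.
move=> vP sf; have [ch _ _ _] := vP.
pose c j := (-1) ^+ j * alt_sum j (fun k => f.[k%:R]) / j`!%:R.
pose P j : {poly K} := \prod_(i < j) ('X - (i%:R)%:P).
suff fE : f = \sum_(0 <= j < l.+1) c j *: P j.
  by rewrite {1}fE horner_sum; apply: eq_bigr => j _; rewrite hornerZ intr_ffactz.
apply/eqP; rewrite -subr_eq0; apply/eqP.
apply: (@roots_geq_poly_eq0 _ _ [seq k%:R : K | k <- iota 0 l.+1]).
- apply/allP => _ /mapP[k kl ->]; move: kl; rewrite mem_iota add0n ltnS => /andP[_ kl].
  rewrite /root hornerD hornerN horner_sum subr_eq0.
  rewrite (newton_forward _ (fun k => f.[k%:R]) k l kl); apply/eqP.
  apply: eq_bigr => t _; rewrite hornerZ /P -[k%:R in RHS]/(k%:Z%:~R) -intr_ffactz.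
  rewrite ffactz_nat -bin_ffact /c PoszM rmorphM /= -!pmulrn.
  have t0 : t`!%:R != 0 :> K by apply/ch/fact_gt0.
  by field.
- by rewrite map_inj_uniq ?iota_uniq //; exact: natr_inj vP.
- rewrite size_map size_iota (leq_trans (size_polyD _ _)) // geq_max sf size_polyN.
  rewrite big_nat_cond; apply: (leq_trans (size_sum _ _ _)).
  apply/bigmax_leqP_seq => j _ /andP[/andP[_ jl] _].
  rewrite (leq_trans (size_scale_leq _ _)) // /P size_prod_XsubC.
  by rewrite -[size _]/(size (index_enum _)) /index_enum -enumT size_enum_ord.
Qed.

Theorem theorem1p2 (p : nat) (K : fieldType) (v : K -> int)
    (alpha n l : nat) (r : int) (f : {poly K}) :
  prime p ->
  padic_valuation p v ->
  (size f <= l.+1)%N ->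
  (forall a : int, in_val_ring v f.[a%:~R]) ->
  let S := \sum_(0 <= k < n.+1 | ((k%:Z - r) %% (p ^ alpha)%:Z)%Z == 0)
             'C(n, k)%:R * (-1) ^+ k * f.[(k%:Z - r)%:~R / (p ^ alpha)%:R] in
  S = 0 \/
  (logn p (floor_div_pow p alpha n)`!)%:Z - l%:Z - (logn p l`!)%:Z
    + (tau p (frac_part p alpha r) (frac_part p alpha (n%:Z - r)))%:Z
    <= v S.
Proof.
move=> pp vP sf fint S.
have [ch _ _ _] := vP.
have q0 : (p ^ alpha)%:R != 0 :> K by rewrite ch // expn_gt0 prime_gt0.
pose c j := (-1) ^+ j * alt_sum j (fun k => f.[k%:R]).
have SE : S = \sum_(0 <= j < l.+1) c j / j`!%:R
    * (alt_sum n (on_class (p ^ alpha) r (ffactz j)))%:~R.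
  transitivity (alt_sum n (on_class (p ^ alpha) r (fun x => f.[x%:~R]))).
    rewrite /S big_mkcond; apply: eq_bigr => k _; rewrite /on_class.
    rewrite (sameP eqP dvdz_mod0P).
    case: ifP => h; last by rewrite mulr0.
    (* On the class, division by p^alpha is exact in [int] and agrees with that in [K]. *)
    by rewrite -{1}(divzK h) rmorphM /= -pmulrn mulfK.
  have -> : alt_sum n (on_class (p ^ alpha) r (fun x => f.[x%:~R]))
      = alt_sum n (fun k => \sum_(0 <= j < l.+1) c j / j`!%:R
          * (on_class (p ^ alpha) r (ffactz j) k)%:~R).
    apply: eq_alt_sum => k _; rewrite /on_class; case: ifP => _.
      exact: newton_poly vP sf.
    by rewrite big1 // => j _; rewrite mulr0.
  rewrite alt_sum_exchange; apply: eq_bigr => j _.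
  rewrite alt_sumZ /alt_sum rmorph_sum; congr (_ * _); apply: eq_bigr => k _.
  by rewrite !rmorphM rmorph_nat rmorphXn rmorphN1.
(* Integer combinations of values of f at integers are integral. *)
have cint j : val_ge v 0 (c j).
  have vz z : val_ge v 0 z%:~R by apply: (val_ge_int p K v vP 0 z pp); rewrite dvd1z.
  have vM0 x y : val_ge v 0 x -> val_ge v 0 y -> val_ge v 0 (x * y).
    by move=> x0 y0; rewrite -[0]addr0; apply: (val_geM _ _ _ vP).
  have vsign i : val_ge v 0 ((-1) ^+ i).
    by rewrite -(rmorph_sign (intr : int -> K)); apply: vz.
  apply: (vM0) => //; rewrite /alt_sum; apply: (val_ge_sum _ _ _ vP) => k _.
  apply: (vM0); last exact: (fint k%:Z).
  by apply: (vM0) => //; exact: (vz 'C(j, k)).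
rewrite -/(val_ge _ _ _) SE; apply: (val_ge_sum _ _ _ vP) => j.
rewrite mem_index_iota ltnS => /andP[_ jl].
set U := alt_sum n _; set T := tau p _ _; set L := logn p _.
have pj0 : p%:R ^+ j != 0 :> K by rewrite expf_neq0 // ch // prime_gt0.
(* The inverse of j! costs ord_p(j!) and that of p^j costs j, both largest at j = l; the last factor
   is bounded by [ffactz_sum_dvd]. *)
have -> : c j / j`!%:R * U%:~R = c j * (j`!%:R^-1 * ((p ^ j)%N%:R^-1 * (p%:Z ^+ j * U)%:~R)).
  by rewrite rmorphM rmorphXn /= -pmulrn natrX mulKf // mulrA.
have h1 := val_ge_inv _ _ _ vP _ (fact_gt0 j).
have h2 : val_ge v (- j%:Z) (p ^ j)%N%:R^-1.
  by rewrite -[j in - j%:Z](pfactorK _ pp); apply: (val_ge_inv _ _ _ vP); rewrite expn_gt0 prime_gt0.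
have h3 := val_ge_int _ _ _ vP _ _ pp (ffactz_sum_dvd p alpha n j r pp).
apply: val_ge_le (val_geM _ _ _ vP _ _ _ _ (cint j)
  (val_geM _ _ _ vP _ _ _ _ h1 (val_geM _ _ _ vP _ _ _ _ h2 h3))).
have lj : (logn p j`! <= logn p l`!)%N.
  by apply: dvdn_leq_log; rewrite ?fact_gt0 // -(bin_fact jl) mulnCA dvdn_mulr.
rewrite -/T -/L; lia.
Qed.
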